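(* Let $\mathscr{Q}$ be a commutative semicartesian quantale, let $\mathrm{E}\mathscr{Q}$ be its set of idempotent elements, and let $\top=(\mathrm{E}\mathscr{Q},\delta)$ with $\delta(e,e')=e\otimes e'$ be the terminal $\mathscr{Q}$-set. Let $\Omega$ be the $\mathscr{Q}$-set whose underlying set is the disjoint union $\mathrm{E}\mathscr{Q}\times\{0,1\}$ of two copies of $\mathrm{E}\mathscr{Q}$, with $$\delta((e,i),(e',j))=e\otimes e',$$ and let $t:\top\to\Omega$ be the morphism $t(e)=(e,1)$. Then $t:\top\to\Omega$ is a classifier for the regular subobjects in the category $\mathscr{Q}\text{-}\mathbf{Set}$ of $\mathscr{Q}$-sets and functional morphisms.
   Context: A quantale $\mathscr{Q}=(|\mathscr{Q}|,\leq,\otimes)$ is a complete lattice with an associative binary operation $\otimes$ that distributes over arbitrary suprema (including the empty one) in each variable. It is commutative if $\otimes$ is commutative, and semicartesian if $a\otimes b\leq a\wedge b$ for all $a,b$. A $\mathscr{Q}$-set is a set $X$ with a map $\delta:X\times X\to\mathscr{Q}$ such that for all $x,y,z\in X$: (1) $\delta(x,y)=\delta(y,x)$; (2) $\delta(x,y)\otimes\delta(y,z)\leq\delta(x,z)$; (3) $\delta(x,x)\otimes\delta(x,y)=\delta(x,y)$. The extent of $x$ is $\mathrm{E}x=\delta(x,x)$. A functional morphism $f:X\to Y$ of $\mathscr{Q}$-sets is a function between the underlying sets with $\delta_X(x,x')\leq\delta_Y(f(x),f(x'))$ and $\mathrm{E}f(x)=\mathrm{E}x$ for all $x,x'\in X$.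 $\mathscr{Q}\text{-}\mathbf{Set}$ is the category of $\mathscr{Q}$-sets and functional morphisms. That $t:\top\to\Omega$ classifies regular subobjects means: $t$ is a regular monomorphism and for every regular monomorphism $f:X\to Y$ there is a unique morphism $\chi_f:Y\to\Omega$ such that the square with $f:X\to Y$, $!_X:X\to\top$, $\chi_f:Y\to\Omega$ and $t:\top\to\Omega$ commutes and is a pullback. *)

(* Defs.v *)
From Stdlib Require Import Relations FunctionalExtensionality ProofIrrelevance.

Set Implicit Arguments.
Unset Strict Implicit.

Record category := Category {
  obj :> Type;
  hom : obj -> obj -> Type;
  idm : forall X, hom X X;
  comp : forall X Y Z, hom Y Z -> hom X Y -> hom X Z;
  comp_idl : forall X Y (f : hom X Y), comp (idm Y) f = f;
  comp_idr : forall X Y (f : hom X Y), comp f (idm X) = f;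
  comp_assoc : forall W X Y Z (h : hom Y Z) (g : hom X Y) (f : hom W X),
    comp h (comp g f) = comp (comp h g) f
}.

Arguments hom {c} X Y.
Arguments idm {c} X.
Arguments comp {c X Y Z} g f.

Declare Scope cat_scope.
Delimit Scope cat_scope with cat.
Local Open Scope cat_scope.
Notation "g \o f" := (comp g f) (at level 50, left associativity) : cat_scope.

Record terminal (C : category) := Terminal {
  terminal_obj :> obj C;
  bang : forall X : C, hom X terminal_obj;
  bang_unique : forall (X : C) (f : hom X terminal_obj), f = bang X
}.

Arguments bang {C} t X.

Definition is_equalizer (C : category) (X Y Z : C)
    (f : hom X Y) (g h : hom Y Z) : Prop :=
  g \o f = h \o f /\
  forall (W : C) (k : hom W Y), g \o k = h \o k ->
    exists! u : hom W X, f \o u = k.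

Definition regular_mono (C : category) (X Y : C) (f : hom X Y) : Prop :=
  exists (Z : C) (g h : hom Y Z), is_equalizer f g h.

(** The square with left side [f], top [p], bottom [q] and right side [g]:
<<
      X --p--> A
      |        |
      f        g
      v        v
      Y --q--> B
>> *)
Definition is_pullback (C : category) (X Y A B : C)
    (f : hom X Y) (p : hom X A) (q : hom Y B) (g : hom A B) : Prop :=
  q \o f = g \o p /\
  forall (W : C) (k : hom W Y) (l : hom W A), q \o k = g \o l ->
    exists! u : hom W X, f \o u = k /\ p \o u = l.

Definition classifies_regular_subobjects (C : category) (T : terminal C)
    (Om : C) (t : hom (terminal_obj T) Om) : Prop :=
  regular_mono t /\
  forall (X Y : C) (f : hom X Y), regular_mono f ->
    exists! chi : hom Y Om, is_pullback f (bang T X) chi t.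

Arguments classifies_regular_subobjects {C} T Om t.

(** Every subset, including the empty one, has a supremum, so distributivity
    gives in particular [qmul a bottom = bottom = qmul bottom a]. *)
Record quantale := Quantale {
  qcar :> Type;
  qle : qcar -> qcar -> Prop;
  qsup : (qcar -> Prop) -> qcar;
  qmul : qcar -> qcar -> qcar;
  qle_order : order qcar qle;
  qsup_ub : forall (S : qcar -> Prop) a, S a -> qle a (qsup S);
  qsup_least : forall (S : qcar -> Prop) b,
    (forall a, S a -> qle a b) -> qle (qsup S) b;
  qmul_assoc : forall a b c, qmul a (qmul b c) = qmul (qmul a b) c;
  qmul_sup_r : forall a (S : qcar -> Prop),
    qmul a (qsup S) = qsup (fun c => exists s, S s /\ c = qmul a s);
  qmul_sup_l : forall (S : qcar -> Prop) a,
    qmul (qsup S) a = qsup (fun c => exists s, S s /\ c = qmul s a)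
}.

Declare Scope quantale_scope.
Delimit Scope quantale_scope with Q.
Local Open Scope quantale_scope.
Notation "a <= b" := (qle a b) : quantale_scope.
Notation "a * b" := (qmul a b) : quantale_scope.

Definition qmeet (Q : quantale) (a b : Q) : Q :=
  qsup (fun c => c <= a /\ c <= b).

Definition commutative (Q : quantale) : Prop := forall a b : Q, a * b = b * a.

Definition semicartesian (Q : quantale) : Prop :=
  forall a b : Q, a * b <= qmeet a b.

Record qset (Q : quantale) := QSetObj {
  qset_car :> Type;
  delta : qset_car -> qset_car -> Q;
  delta_sym : forall x y, delta x y = delta y x;
  delta_trans : forall x y z, delta x y * delta y z <= delta x z;
  delta_extent : forall x y, delta x x * delta x y = delta x y
}.

Arguments delta {Q q} x y.

Definition extent (Q : quantale) (X : qset Q) (x : X) : Q := delta x x.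

Record fmorphism (Q : quantale) (X Y : qset Q) := FMorphism {
  fmap :> X -> Y;
  fmap_delta : forall x x', delta x x' <= delta (fmap x) (fmap x');
  fmap_extent : forall x, extent (fmap x) = extent x
}.

Lemma qle_refl (Q : quantale) (a : Q) : a <= a.
Proof. apply (ord_refl _ _ (qle_order Q)). Qed.

Lemma qle_trans (Q : quantale) (a b c : Q) : a <= b -> b <= c -> a <= c.
Proof. apply (ord_trans _ _ (qle_order Q)). Qed.

Lemma qmul_mono_l (Q : quantale) (a b c : Q) : a <= b -> a * c <= b * c.
Proof.
intro H.
assert (E : b = qsup (fun x => x = a \/ x = b)).
{ apply (ord_antisym _ _ (qle_order Q)).
  - apply qsup_ub; right; reflexivity.
  - apply qsup_least; intros x [->| ->]; [exact H | apply qle_refl]. }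
rewrite E, qmul_sup_l; apply qsup_ub.
exists a; split; [left|]; reflexivity.
Qed.

Lemma qmul_mono_r (Q : quantale) (a b c : Q) : a <= b -> c * a <= c * b.
Proof.
intro H.
assert (E : b = qsup (fun x => x = a \/ x = b)).
{ apply (ord_antisym _ _ (qle_order Q)).
  - apply qsup_ub; right; reflexivity.
  - apply qsup_least; intros x [->| ->]; [exact H | apply qle_refl]. }
rewrite E, qmul_sup_r; apply qsup_ub.
exists a; split; [left|]; reflexivity.
Qed.

Lemma fmorphism_eq (Q : quantale) (X Y : qset Q) (f g : fmorphism X Y) :
  (forall x, f x = g x) -> f = g.
Proof.
destruct f as [f f1 f2], g as [g g1 g2]; simpl; intro H.
assert (E : f = g) by (apply functional_extensionality; exact H).
subst g; f_equal; apply proof_irrelevance.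
Qed.

Definition fid (Q : quantale) (X : qset Q) : fmorphism X X :=
  FMorphism (fmap := fun x => x)
    (fun x x' => qle_refl (delta x x')) (fun x => eq_refl).

Definition fcomp (Q : quantale) (X Y Z : qset Q)
    (g : fmorphism Y Z) (f : fmorphism X Y) : fmorphism X Z :=
  FMorphism (fmap := fun x => g (f x))
    (fun x x' => qle_trans (fmap_delta f x x') (fmap_delta g (f x) (f x')))
    (fun x => eq_trans (fmap_extent g (f x)) (fmap_extent f x)).

Definition QSet (Q : quantale) : category.
Proof.
refine (@Category (qset Q) (@fmorphism Q) (@fid Q) (@fcomp Q) _ _ _);
  intros; apply fmorphism_eq; reflexivity.
Defined.

Lemma qmul_le_l (Q : quantale) (Qs : semicartesian Q) (a b : Q) : a * b <= a.
Proof.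
apply (qle_trans (Qs a b)); apply qsup_least; intros c [H _]; exact H.
Qed.

Lemma qmul_le_r (Q : quantale) (Qs : semicartesian Q) (a b : Q) : a * b <= b.
Proof.
apply (qle_trans (Qs a b)); apply qsup_least; intros c [_ H]; exact H.
Qed.

Definition idem (Q : quantale) : Type := {e : Q | e * e = e}.

Definition idem_val (Q : quantale) (e : idem Q) : Q := proj1_sig e.
Coercion idem_val : idem >-> qcar.

Lemma idem_inj (Q : quantale) (e e' : idem Q) : (e : Q) = e' -> e = e'.
Proof.
destruct e as [e He], e' as [e' He']; simpl; intro H; subst e'.
f_equal; apply proof_irrelevance.
Qed.

Lemma idem_delta_trans (Q : quantale) (Qs : semicartesian Q) (a b c : idem Q) :
  (a * b) * (b * c) <= a * c.
Proof.
apply qle_trans with (a * (b * c)).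
- apply qmul_mono_l, (qmul_le_l Qs).
- apply qmul_mono_r, (qmul_le_r Qs).
Qed.

Lemma idem_delta_extent (Q : quantale) (a b : idem Q) :
  (a * a) * (a * b) = a * b.
Proof.
rewrite (proj2_sig a : a * a = a), qmul_assoc, (proj2_sig a : a * a = a).
reflexivity.
Qed.

Definition top_qset (Q : quantale) (Qc : commutative Q)
    (Qs : semicartesian Q) : QSet Q :=
  @QSetObj Q (idem Q) (fun e e' => e * e')
    (fun e e' => Qc e e')
    (fun e e' e'' => idem_delta_trans Qs e e' e'')
    (fun e e' => idem_delta_extent e e').

Lemma delta_le_extents (Q : quantale) (Qs : semicartesian Q)
    (X : qset Q) (x x' : X) : delta x x' <= extent x * extent x'.
Proof.
rewrite <- (delta_extent x x'); apply qmul_mono_r.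
rewrite (delta_sym x x'), <- (delta_extent x' x); apply (qmul_le_l Qs).
Qed.

Definition extent_idem (Q : quantale) (X : qset Q) (x : X) : idem Q :=
  exist _ (extent x) (delta_extent x x).

Definition top_bang (Q : quantale) (Qc : commutative Q) (Qs : semicartesian Q)
    (X : QSet Q) : hom X (top_qset Qc Qs) :=
  @FMorphism Q X (top_qset Qc Qs) (@extent_idem Q X)
    (@delta_le_extents Q Qs X) (fun x => delta_extent x x).

Lemma top_bang_unique (Q : quantale) (Qc : commutative Q)
    (Qs : semicartesian Q) (X : QSet Q) (f : hom X (top_qset Qc Qs)) :
  f = top_bang Qc Qs X.
Proof.
apply fmorphism_eq; intro x; apply idem_inj.
exact (eq_trans (eq_sym (proj2_sig (fmap f x))) (fmap_extent f x)).
Qed.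

Definition top_terminal (Q : quantale) (Qc : commutative Q)
    (Qs : semicartesian Q) : terminal (QSet Q) :=
  Terminal (@top_bang_unique Q Qc Qs).

(** The tag [true] marks copy 1 and [false] copy 0. *)
Definition Omega_qset (Q : quantale) (Qc : commutative Q)
    (Qs : semicartesian Q) : QSet Q :=
  @QSetObj Q (idem Q * bool)%type (fun u v => fst u * fst v)
    (fun u v => Qc (fst u) (fst v))
    (fun u v w => idem_delta_trans Qs (fst u) (fst v) (fst w))
    (fun u v => idem_delta_extent (fst u) (fst v)).

Definition truth (Q : quantale) (Qc : commutative Q) (Qs : semicartesian Q) :
    hom (terminal_obj (top_terminal Qc Qs)) (Omega_qset Qc Qs) :=
  @FMorphism Q (top_qset Qc Qs) (Omega_qset Qc Qs) (fun e => (e, true))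
    (fun e e' : idem Q => qle_refl (e * e')) (fun e => eq_refl).

(* Main.v *)
From Stdlib Require Import ClassicalEpsilon.
Require Import Defs.

(** The map [truth] is a global element of [Omega], hence split by [bang], hence
    the equalizer of the identity and [truth \o bang]
    ([regular_mono_from_terminal]).

    Now let [f : X -> Y] be the equalizer of [g] and [h].  A morphism preserves
    extents, so the first component of [chi y] must be the extent of [y]
    ([fst_to_Omega]) and only the truth value of [chi y] can be chosen: a
    morphism into [Omega] is the same thing as a subset of [Y]
    ([Omega_char], [to_Omega_eq]).  A morphism [k] satisfies [chi \o k = truth \o l]
    for some (unique) [l] exactly when the subset contains all values of [k]
    ([to_Omega_factor]).  For the subset [{y | g y = h y}] this condition says
    [g \o k = h \o k], so the universal property of the pullback is that of the
    equalizer.  Conversely, testing the universal properties on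
    one-point Q-sets [{y}] shows that equalizers and pullbacks of [truth] both
    have a prescribed image ([equalizer_image], [pullback_truth_image]): any
    [chi] making the square a pullback has truth value [true] precisely on the
    image of [f], and is therefore unique. *)

Set Implicit Arguments.
Unset Strict Implicit.

Local Open Scope cat_scope.

Lemma regular_mono_from_terminal (C : category) (T : terminal C) (Z : C)
    (t : hom (terminal_obj T) Z) : regular_mono t.
Proof.
exists Z, (idm Z), (t \o bang T Z); split.
- rewrite <- comp_assoc, comp_idl.
  rewrite (bang_unique (bang T Z \o t)), <- (bang_unique (idm (terminal_obj T))).
  symmetry; apply comp_idr.
- intros W k Hk; exists (bang T W); split.
  + rewrite comp_idl, <- comp_assoc in Hk.
    rewrite (bang_unique (bang T Z \o k)) in Hk; symmetry; exact Hk.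
  + intros u _; symmetry; apply bang_unique.
Qed.

Section QSets.

Variables (Q : quantale) (Qc : commutative Q) (Qs : semicartesian Q).

Lemma fmorphism_apply (X Y : QSet Q) (f g : hom X Y) (x : X) :
  f = g -> fmap f x = fmap g x.
Proof. intros ->; reflexivity. Qed.

(** The one-point Q-set whose point has the same extent as [y]. *)
Definition point_qset (Y : QSet Q) (y : qset_car Y) : QSet Q :=
  @QSetObj Q unit (fun _ _ => delta y y)
    (fun _ _ => eq_refl)
    (fun _ _ _ => delta_trans y y y)
    (fun _ _ => delta_extent y y).

(** The morphism from the one-point Q-set that picks out [y]. *)
Definition point (Y : QSet Q) (y : qset_car Y) : hom (point_qset y) Y :=
  @FMorphism Q (point_qset y) Y (fun _ => y)
    (fun _ _ => qle_refl (delta y y)) (fun _ => eq_refl).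

Lemma equalizer_image (X Y Z : QSet Q) (f : hom X Y) (g h : hom Y Z) :
  is_equalizer f g h ->
  forall y, fmap g y = fmap h y <-> exists x, fmap f x = y.
Proof.
intros [E U] y; split.
- intro Hy; destruct (U _ (point y)) as [u [Hu _]].
  + apply fmorphism_eq; intros []; exact Hy.
  + exists (fmap u tt); exact (fmorphism_apply (X := point_qset y) tt Hu).
- intros [x <-]; exact (fmorphism_apply x E).
Qed.

Lemma fst_to_Omega (Y : QSet Q) (chi : hom Y (Omega_qset Qc Qs)) (y : Y) :
  fst (fmap chi y) = extent_idem y.
Proof.
apply idem_inj.
exact (eq_trans (eq_sym (proj2_sig (fst (fmap chi y)))) (fmap_extent chi y)).
Qed.

Lemma to_Omega_eq (Y : QSet Q) (chi chi' : hom Y (Omega_qset Qc Qs)) :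
  (forall y, snd (fmap chi y) = true <-> snd (fmap chi' y) = true) ->
  chi = chi'.
Proof.
intro H; apply fmorphism_eq; intro y; specialize (H y).
apply injective_projections.
- transitivity (extent_idem y); [|symmetry]; apply fst_to_Omega.
- destruct (snd (fmap chi y)), (snd (fmap chi' y)); intuition congruence.
Qed.

Lemma to_Omega_factor (W Y : QSet Q) (chi : hom Y (Omega_qset Qc Qs))
    (k : hom W Y) (l : hom W (top_terminal Qc Qs)) :
  chi \o k = truth Qc Qs \o l <->
  forall w, snd (fmap chi (fmap k w)) = true.
Proof.
split.
- intros H w; exact (f_equal snd (fmorphism_apply w H)).
- intro H; apply to_Omega_eq; intro w; simpl; rewrite H; tauto.
Qed.

Lemma pullback_truth_image (X Y : QSet Q) (f : hom X Y)
    (p : hom X (top_terminal Qc Qs)) (chi : hom Y (Omega_qset Qc Qs)) :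
  is_pullback f p chi (truth Qc Qs) ->
  forall y, snd (fmap chi y) = true <-> exists x, fmap f x = y.
Proof.
intros [E U] y; split.
- intro Hy.
  destruct (U _ (point y) (bang (top_terminal Qc Qs) _)) as [u [[Hu _] _]].
  + apply to_Omega_factor; intros []; exact Hy.
  + exists (fmap u tt); exact (fmorphism_apply (X := point_qset y) tt Hu).
- intros [x <-]; exact (proj1 (to_Omega_factor chi f p) E x).
Qed.

(** The morphism into [Omega] given by the subset [P] of [Y]; it exists for
    every [P] because [delta] on [Omega] ignores truth values.  Membership in
    [P] is decided classically. *)
Definition Omega_char (Y : QSet Q) (P : qset_car Y -> Prop) :
    hom Y (Omega_qset Qc Qs) :=
  @FMorphism Q Y (Omega_qset Qc Qs)
    (fun y => (extent_idem y,
               if excluded_middle_informative (P y) then true else false))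
    (fun y y' => delta_le_extents Qs y y') (fun y => delta_extent y y).

Lemma Omega_char_true (Y : QSet Q) (P : qset_car Y -> Prop) (y : qset_car Y) :
  snd (fmap (Omega_char P) y) = true <-> P y.
Proof.
simpl; destruct (excluded_middle_informative (P y)); intuition congruence.
Qed.

Lemma equalizer_pullback_truth (X Y Z : QSet Q) (f : hom X Y) (g h : hom Y Z) :
  is_equalizer f g h ->
  is_pullback f (bang (top_terminal Qc Qs) X)
    (Omega_char (fun y => fmap g y = fmap h y)) (truth Qc Qs).
Proof.
intros [E U]; split.
- apply to_Omega_factor; intro x; apply Omega_char_true.
  exact (fmorphism_apply x E).
- intros W k l H.
  destruct (U W k) as [u [Hu Huniq]].
  + apply fmorphism_eq; intro w.
    apply (Omega_char_true (fun y => fmap g y = fmap h y)).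
    exact (proj1 (to_Omega_factor _ k l) H w).
  + exists u; split.
    * split; [exact Hu|].
      rewrite (bang_unique l); apply bang_unique.
    * intros v [Hv _]; exact (Huniq v Hv).
Qed.

End QSets.

Theorem mainTheorem9 (Q : quantale) (Qc : commutative Q)
    (Qs : semicartesian Q) :
  classifies_regular_subobjects
    (top_terminal Qc Qs) (Omega_qset Qc Qs) (truth Qc Qs).
Proof.
split; [apply regular_mono_from_terminal|].
intros X Y f [Z [g [h Hf]]].
exists (Omega_char Qc Qs (fun y => fmap g y = fmap h y)); split.
- apply equalizer_pullback_truth; exact Hf.
- intros chi Hchi; apply to_Omega_eq; intro y.
  rewrite Omega_char_true, (equalizer_image Hf), (pullback_truth_image Hchi).
  tauto.
Qed.
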